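(* Let $\mathcal{A}=(Q,E,s,F)$ be an NFA and let $\mathcal{A}^*=(Q^*,E^*,s^*,F^* )$ be the powerset automaton obtained from $\mathcal{A}$. Let $n_{\preceq_\mathcal{A}}=|Q/_{\preceq_\mathcal{A}}|$ and $n^*=|Q^*|$. Let $r$ be the width of $\preceq_\mathcal{A}$ and $r^*$ the width of $\preceq_{\mathcal{A}^*}$. Then (1) $r^*\le 2^r-1$; (2) $n^*\le 2^r(n_{\preceq_\mathcal{A}}-r+1)-1$.
   Context: $\Sigma$ is a finite alphabet with a fixed total order $\preceq$, extended to $\Sigma^*$ co-lexicographically: $\alpha\preceq\beta$ iff the reverse of $\alpha$ is lexicographically $\le$ the reverse of $\beta$ ($\prec$ its strict part). An NFA is $\mathcal{A}=(Q,E,s,F)$ with finite state set $Q$, $E\subseteq Q\times Q\times\Sigma$, initial state $s$ and final states $F$; it is assumed that every state is reachable from $s$ and every state can reach a final state. $\mathcal{L}(\mathcal{A})$ is the recognized language and $Pref(\mathcal{L}(\mathcal{A}))$ its set of prefixes. For $u\in Q$, $I_u$ is the set of strings that can be read from $s$ to $u$; for $\alpha\in Pref(\mathcal{L}(\mathcal{A}))$, $I_\alpha$ is the set of states $u$ with $\alpha\in I_u$. On $\{I_u:u\in Q\}$, $\preceq$ is the reflexive relation such that for $I_u\neq I_v$: $I_u\prec I_v$ iff for all $\alpha\in I_u$, $\beta\in I_v$ with $\{\alpha,\beta\}\not\subseteq I_u\cap I_v$, $\alpha\prec\beta$. Define $u\preceq_\mathcal{A} v$ iff $I_u\preceq I_v$;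 this is a preorder on $Q$. $Q/_{\preceq_\mathcal{A}}$ is the set of equivalence classes of the relation $u\sim v$ iff $u\preceq_\mathcal{A}v$ and $v\preceq_\mathcal{A}u$. The width of a preorder is the minimum size of a partition of its ground set into sets whose elements are pairwise comparable. The powerset automaton has $Q^*=\{I_\alpha:\alpha\in Pref(\mathcal{L}(\mathcal{A}))\}$, $E^*=\{(I_\alpha,I_{\alpha a},a): \alpha a\in Pref(\mathcal{L}(\mathcal{A}))\}$, $s^*=I_\varepsilon=\{s\}$, $F^*=\{I_\alpha:\alpha\in\mathcal{L}(\mathcal{A})\}$; $\preceq_{\mathcal{A}^*}$ is defined on the DFA $\mathcal{A}^*$ in the same way as $\preceq_\mathcal{A}$ on $\mathcal{A}$. *)

(* Defs.v *)
From HB Require Import structures.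
From mathcomp Require Import all_boot all_order all_algebra.
From mathcomp Require Import boolp.

Set Implicit Arguments.
Unset Strict Implicit.
Unset Printing Implicit Defensive.

(* [seqlexi] is the lexicographic order in which a proper prefix is smaller. *)
Definition colex_lt (d : Order.disp_t) (Sigma : finOrderType d)
    (alpha beta : seq Sigma) : bool :=
  ((rev alpha : seqlexi Sigma) < (rev beta : seqlexi Sigma))%O.

(* [reads E u w v]: some path from [u] to [v] using edges of [E] is labelled
   [w]; an edge [(x, y, a)] goes from [x] to [y] with label [a]. *)
Fixpoint reads (Sigma Q : finType) (E : {set Q * Q * Sigma})
    (u : Q) (w : seq Sigma) (v : Q) : bool :=
  if w is a :: w' then [exists x, ((u, x, a) \in E) && reads E x w' v]
  else u == v.

Record nfa (Sigma : finType) : Type := Nfa {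
  state : finType;
  edges : {set state * state * Sigma};
  init : state;
  final : {set state};
  nfa_reachable : forall u, exists w, reads edges init w u;
  nfa_coreachable : forall u, exists w v, v \in final /\ reads edges u w v
}.

Definition language (Sigma : finType) (A : nfa Sigma) : pred (seq Sigma) :=
  fun w => [exists v in final A, reads (edges A) (init A) w v].

Definition pref (T : Type) (L : pred (seq T)) (alpha : seq T) : Prop :=
  exists beta, L (alpha ++ beta).

Definition Istate (Sigma : finType) (A : nfa Sigma) (u : state A) :
    pred (seq Sigma) :=
  fun w => reads (edges A) (init A) w u.

Definition Istring (Sigma : finType) (A : nfa Sigma) (alpha : seq Sigma) :
    {set state A} :=
  [set u | Istate u alpha].

Definition lang_prec (d : Order.disp_t) (Sigma : finOrderType d)
    (X Y : pred (seq Sigma)) : Prop :=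
  ~ (X =1 Y) /\
  forall alpha beta, X alpha -> Y beta ->
    ~ ((X alpha /\ Y alpha) /\ (X beta /\ Y beta)) -> colex_lt alpha beta.

Definition lang_preceq (d : Order.disp_t) (Sigma : finOrderType d)
    (X Y : pred (seq Sigma)) : Prop :=
  X =1 Y \/ lang_prec X Y.

Definition preceq (d : Order.disp_t) (Sigma : finOrderType d)
    (A : nfa Sigma) : rel (state A) :=
  fun u v => `[< lang_preceq (Istate u) (Istate v) >].

Definition preorder_quotient (T : finType) (le : rel T) : {set {set T}} :=
  equivalence_partition (fun x y => le x y && le y x) [set: T].

Definition chain (T : finType) (le : rel T) (B : {set T}) : bool :=
  [forall x in B, forall y in B, (x != y) ==> (le x y || le y x)].

Definition chain_partition (T : finType) (le : rel T) (P : {set {set T}}) :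
    bool :=
  partition P [set: T] && [forall B in P, chain le B].

Lemma chain_partition_exists (T : finType) (le : rel T) :
  exists n, [exists P, chain_partition le P && (#|P| == n)].
Proof.
exists #|equivalence_partition (@eq_op T) [set: T]|; apply/existsP.
exists (equivalence_partition (@eq_op T) [set: T]); rewrite eqxx andbT.
apply/andP; split.
  by apply: equivalence_partitionP => x y z _ _ _; split=> // /eqP->.
apply/forall_inP=> B /imsetP[x _ ->]; apply/forall_inP=> y.
rewrite !inE => /eqP<-; apply/forall_inP=> z.
by rewrite !inE => /eqP<-; rewrite eqxx.
Qed.

Definition width (T : finType) (le : rel T) : nat :=
  ex_minn (chain_partition_exists le).

Definition Qstar (Sigma : finType) (A : nfa Sigma) : {set {set state A}} :=
  [set X | `[< exists alpha, pref (language A) alpha /\ X = Istring A alpha >]].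

Definition pstate (Sigma : finType) (A : nfa Sigma) : finType :=
  {X : {set state A} | X \in Qstar A}.

Definition pedges (Sigma : finType) (A : nfa Sigma) :
    {set pstate A * pstate A * Sigma} :=
  [set e | `[< exists alpha, [/\ pref (language A) (rcons alpha e.2),
     val e.1.1 = Istring A alpha & val e.1.2 = Istring A (rcons alpha e.2)] >]].

Definition pfinal (Sigma : finType) (A : nfa Sigma) : {set pstate A} :=
  [set X | `[< exists alpha, language A alpha /\ val X = Istring A alpha >]].

Lemma pref_cat (T : Type) (L : pred (seq T)) (alpha beta : seq T) :
  pref L (alpha ++ beta) -> pref L alpha.
Proof. by case=> gamma Lg; exists (beta ++ gamma); rewrite catA. Qed.

Lemma Istring_Qstar (Sigma : finType) (A : nfa Sigma) (alpha : seq Sigma) :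
  pref (language A) alpha -> Istring A alpha \in Qstar A.
Proof. by move=> pA; rewrite inE; apply/asboolP; exists alpha. Qed.

Definition pstate_of (Sigma : finType) (A : nfa Sigma) (alpha : seq Sigma)
    (pA : pref (language A) alpha) : pstate A :=
  exist (fun X => X \in Qstar A) (Istring A alpha) (Istring_Qstar pA).

Lemma pref_nil (Sigma : finType) (A : nfa Sigma) : pref (language A) [::].
Proof.
have [w [v [vF rw]]] := nfa_coreachable (init A).
by exists w; apply/exists_inP; exists v.
Qed.

Definition pinit (Sigma : finType) (A : nfa Sigma) : pstate A :=
  pstate_of (pref_nil A).

Lemma preads (Sigma : finType) (A : nfa Sigma) (alpha beta : seq Sigma)
    (X Y : pstate A) :
  pref (language A) (alpha ++ beta) ->
  val X = Istring A alpha -> val Y = Istring A (alpha ++ beta) ->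
  reads (pedges A) X beta Y.
Proof.
elim: beta alpha X => [|a beta IH] alpha X pA vX vY /=.
  by apply/eqP/val_inj; rewrite vX vY cats0.
rewrite -cat_rcons in pA vY.
apply/existsP; exists (pstate_of (pref_cat pA)).
rewrite (IH (rcons alpha a)) // andbT inE; apply/asboolP.
by exists alpha; split=> //=; apply: pref_cat pA.
Qed.

Lemma preachable (Sigma : finType) (A : nfa Sigma) (X : pstate A) :
  exists w, reads (pedges A) (pinit A) w X.
Proof.
have := valP X; rewrite inE => /asboolP[alpha [pA vX]].
by exists alpha; apply: (@preads _ _ [::]).
Qed.

Lemma pcoreachable (Sigma : finType) (A : nfa Sigma) (X : pstate A) :
  exists w Y, Y \in pfinal A /\ reads (pedges A) X w Y.
Proof.
have := valP X; rewrite inE => /asboolP[alpha [[beta Lab] vX]].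
have pab : pref (language A) (alpha ++ beta) by exists [::]; rewrite cats0.
exists beta, (pstate_of pab); split; last exact: preads vX _.
by rewrite inE; apply/asboolP; exists (alpha ++ beta).
Qed.

Definition powerset_nfa (Sigma : finType) (A : nfa Sigma) : nfa Sigma :=
  Nfa (@preachable _ A) (@pcoreachable _ A).

(* Main.v *)
(* The automaton matters only through the family [I_u] of sets of strings:
   [I_alpha] lists the members of the family that contain [alpha].  Colour the
   members by [r] chains and let the support of a set of members be its set of
   colours.  If [I_alpha] and [I_beta] are distinct but have the same support,
   some colour is carried by [u] in [I_alpha] and [v] in [I_beta] with
   [I_u <> I_v]; comparing [u] and [v] fixes the order of every string of the
   class of [alpha] against every string of the class of [beta].  Hence each of
   the [2 ^ r - 1] nonempty supports yields a chain of the powerset automaton.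

   To count, first keep one state for each [I_u], so that there are [n] members.
   Fix a support [K] and let [D_K] be the set of members coloured in [K].
   Along the sets [I_alpha] of support [K], taken in co-lexicographic order, the
   number of members of [D_K] that have been entered plus the number that have
   been passed strictly increases.  It lies between [#|K|] and
   [2 * #|D_K| - #|K|], as [I_alpha] meets all [#|K|] chains; summing over [K]
   gives the bound, since each member lies in half of the [D_K]. *)

Require Import Defs.
From mathcomp Require Import all_boot all_order all_algebra.
From mathcomp Require Import boolp zify.

Import Order.TTheory.

Set Implicit Arguments.
Unset Strict Implicit.
Unset Printing Implicit Defensive.

Lemma card_leq_interval (T : finType) (h : T -> nat) (a b : nat) :
  injective h -> (forall x, a <= h x < b) -> a <= b -> #|T| + a <= b.
Proof.
move=> h_inj h_ab le_ab.
suff: #|T| <= b - a by lia.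
rewrite -[#|T|](size_image h) -(size_iota a (b - a)).
apply: uniq_leq_size => [|_ /imageP[x _ ->]].
  by rewrite map_inj_uniq ?enum_uniq.
by rewrite mem_iota subnKC.
Qed.

Lemma card_set_type (T : finType) : #|{set T}| = 2 ^ #|T|.
Proof. by rewrite -!cardsT -card_powerset powersetT. Qed.

Lemma card_imset_nonempty_sets (S I : finType) (h : S -> {set I}) :
  (forall s, h s != set0) -> #|h @: [set: S]| < 2 ^ #|I|.
Proof.
move=> h_neq0; rewrite -card_set_type -cardsT proper_card // properT.
apply/eqP=> /setP/(_ set0); rewrite inE => /imsetP[s _ /esym/eqP].
by rewrite (negPf (h_neq0 s)).
Qed.

Lemma leq_card_preimset (T I : finType) (f : T -> I) (K : {set I}) :
  f @: [set: T] = setT -> #|K| <= #|f @^-1: K|.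
Proof.
move=> f_surj; apply: leq_trans (leq_imset_card f _).
apply/subset_leq_card/subsetP=> i iK.
have: i \in f @: [set: T] by rewrite f_surj inE.
by case/imsetP=> x _ eq_i; rewrite eq_i imset_f // inE -eq_i.
Qed.

Lemma sum_card_preimset (T I : finType) (f : T -> I) :
  2 * \sum_(K : {set I}) #|f @^-1: K| = 2 ^ #|I| * #|T|.
Proof.
(* Pair each [K] with its complement. *)
rewrite mul2n -addnn {2}(reindex_inj (inv_inj (@setCK I))) -big_split /=.
rewrite (eq_bigr (fun=> #|T|)) => [|K _]; last by rewrite preimsetC cardsC.
by rewrite sum_nat_const card_set_type.
Qed.

Definition chain_colouring (T I : Type) (le : rel T) (f : T -> I) : Prop :=
  forall x y, f x = f y -> le x y || le y x.

Section Width.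

Variable T : finType.
Implicit Type le : rel T.

Lemma width_leq_imset (I : finType) le (f : T -> I) :
  chain_colouring le f -> width le <= #|f @: [set: T]|.
Proof.
move=> f_chain; pose P := preim_partition f [set: T].
apply: (@leq_trans #|P|); last first.
  have -> : P = (fun i => [set y in [set: T] | i == f y]) @: (f @: [set: T]).
    by rewrite -imset_comp.
  exact: leq_imset_card.
rewrite /width; case: ex_minnP => m _; apply; apply/existsP; exists P.
rewrite eqxx andbT /chain_partition preim_partitionP /=.
apply/forall_inP=> _ /imsetP[x _ ->]; apply/forall_inP=> y.
rewrite !inE => /eqP fxy; apply/forall_inP=> z; rewrite !inE => /eqP fxz.
by apply/implyP=> _; apply: f_chain; rewrite -fxy.
Qed.

Lemma width_colouring le :
  reflexive le ->
  exists f : T -> 'I_(width le), chain_colouring le f /\ f @: [set: T] = setT.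
Proof.
move=> le_refl; rewrite /width.
case: ex_minnP => _ /existsP[P /andP[/andP[partP /forall_inP chainP] /eqP<-]] _.
have /and3P[/eqP coverP tiP P0] := partP.
have blockP x : pblock P x \in P by rewrite pblock_mem // coverP inE.
pose f x := enum_rank_in (blockP x) (pblock P x).
have fK x : enum_val (f x) = pblock P x by rewrite enum_rankK_in.
exists f; split=> [x y eq_f|].
  have [->|neq_xy] := eqVneq x y; first by rewrite le_refl.
  have xB : x \in pblock P x by rewrite mem_pblock coverP inE.
  have yB : y \in pblock P x by rewrite -fK eq_f fK mem_pblock coverP inE.
  move/forall_inP: (chainP _ (blockP x)) => /(_ x xB) /forall_inP /(_ y yB).
  by rewrite neq_xy.
apply/setP=> i; rewrite inE; apply/imsetP.
have iP := enum_valP i.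
have /set0Pn[x xi] : enum_val i != set0 by apply: contraNneq P0 => <-.
by exists x => //; apply: enum_val_inj; rewrite fK (def_pblock tiP iP xi).
Qed.

End Width.

Lemma leq_width_reflect (T T' : finType) (le : rel T) (le' : rel T')
    (g : T -> T') :
  reflexive le' -> (forall x y, le' (g x) (g y) -> le x y) ->
  width le <= width le'.
Proof.
move=> /width_colouring[f [f_chain _]] g_reflects.
apply: leq_trans (leq_trans (max_card _) (eq_leq (card_ord _))).
apply: (@width_leq_imset _ _ _ (f \o g)) => x y /f_chain.
by case/orP=> /g_reflects ->; rewrite ?orbT.
Qed.

Lemma preorder_quotient_section (T : finType) (le : rel T) :
  reflexive le ->
  exists (C : finType) (repr : C -> T) (class : T -> C),
    #|C| = #|preorder_quotient le| /\
    forall x, le x (repr (class x)) && le (repr (class x)) x.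
Proof.
move=> le_refl; pose block x := [set y in [set: T] | le x y && le y x].
have blockP x : block x \in preorder_quotient le by rewrite imset_f.
pose C : finType := {B : {set T} | B \in preorder_quotient le}.
have /choice[repr reprP] (B : C) : exists x, val B = block x.
  by have /imsetP[x _ eqB] := valP B; exists x.
pose class x : C := exist _ (block x) (blockP x).
exists C, repr, class; split=> [|x]; first exact: card_sig.
have /setP/(_ x) := reprP (class x).
by rewrite !inE !le_refl /= andbC => <-.
Qed.

Section Precedes.

Variables (disp : Order.disp_t) (T : orderType disp).
Implicit Types (X Y : pred T) (x y : T).

Definition precedes : rel (pred T) :=
  fun X Y => `[< forall x y, X x -> Y y -> ~~ (Y x && X y) -> (x < y)%O >].

Lemma precedes_refl : reflexive precedes.
Proof. by move=> X; apply/asboolP=> x y -> ->. Qed.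

Lemma precedes_anti X Y :
  (exists x, X x) -> (exists y, Y y) -> precedes X Y -> precedes Y X -> X = Y.
Proof.
have sub X' Y' : (exists y, Y' y) -> precedes X' Y' -> precedes Y' X' ->
    forall x, X' x -> Y' x.
  move=> [y Yy] /asboolP ltXY /asboolP ltYX x Xx; apply: contraT => nYx.
  have lt_xy : (x < y)%O by apply: ltXY; rewrite // (negPf nYx).
  have lt_yx : (y < x)%O by apply: ltYX; rewrite // (negPf nYx) andbF.
  by have := lt_asym x y; rewrite lt_xy lt_yx.
move=> exX exY ltXY ltYX; apply/funext=> x.
by apply/idP/idP; [apply: sub exY _ _ x|apply: sub exX _ _ x].
Qed.

Lemma comparable_precedes X Y x y :
  precedes X Y || precedes Y X -> X x -> Y y -> ~~ (Y x && X y) ->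
  (x < y)%O -> precedes X Y.
Proof.
case/orP=> // /asboolP ltYX Xx Yy sep lt_xy.
by have := ltYX y x Yy Xx; rewrite andbC sep lt_gtF // => /(_ isT).
Qed.

End Precedes.

Section Family.

Variables (disp : Order.disp_t) (T : orderType disp).
Variables (C : finType) (F : C -> pred T).
Implicit Types (x y z : T) (c : C) (Y Z : {set C}).

Definition family_le : rel C := fun c c' => precedes (F c) (F c').

Definition containing x : {set C} := [set c | F c x].

Definition fiber Y : pred T := fun x => containing x == Y.

Definition traces : {set {set C}} :=
  [set Y | (Y != set0) && `[< exists x, containing x = Y >]].

Lemma family_le_refl : reflexive family_le.
Proof. by move=> c; apply: precedes_refl. Qed.

Definition progress x c : nat :=
  `[< exists2 z, F c z & (z <= x)%O >] + `[< forall z, F c z -> (z < x)%O >].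

Lemma progress_leq2 x c : progress x c <= 2.
Proof. exact: leq_add (leq_b1 _) (leq_b1 _). Qed.

Lemma progress_inside x c : F c x -> progress x c = 1.
Proof.
move=> Fcx; rewrite /progress asboolT; last by exists x.
by rewrite asboolF // => /(_ x Fcx); rewrite ltxx.
Qed.

Lemma leq_progress x y c : (x <= y)%O -> progress x c <= progress y c.
Proof.
move=> le_xy; apply: leq_add; case: asboolP => //.
  move=> [z Fcz le_zx]; rewrite asboolT //.
  by exists z; last exact: le_trans le_xy.
by move=> lt_x; rewrite asboolT // => z /lt_x /lt_le_trans ->.
Qed.

Lemma progress_after x c :
  (exists2 z, F c z & (z <= x)%O) -> (forall z, F c z -> (z < x)%O) ->
  progress x c = 2.
Proof. by move=> ? ?; rewrite /progress !asboolT. Qed.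

Lemma progress_before x c :
  (exists z, F c z) -> (forall z, F c z -> (x < z)%O) -> progress x c = 0.
Proof.
move=> [y Fcy] gt_x; rewrite /progress !asboolF //.
  by move/(_ y Fcy); rewrite lt_gtF ?gt_x.
by case=> z /gt_x; rewrite leNgt => ->.
Qed.

Variables (I : finType) (f : C -> I).
Hypothesis f_chain : chain_colouring family_le f.

Definition support x : {set I} := f @: containing x.

Lemma supportP i x : reflect (exists2 c, F c x & i = f c) (i \in support x).
Proof.
apply: (iffP imsetP) => [[c]|[c Fcx ->]]; first by rewrite inE; exists c.
by exists c; rewrite ?inE.
Qed.

Lemma same_support_witness x y :
  support x = support y -> containing x != containing y ->
  (x < y)%O ->
  exists c c', [/\ F c x, F c' y, ~~ (F c' x && F c y) & precedes (F c) (F c')].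
Proof.
move=> eq_supp neq_xy lt_xy.
suff [c [c' [eq_f Fcx Fc'y sep]]] :
    exists c c', [/\ f c = f c', F c x, F c' y & ~~ (F c' x && F c y)].
  exists c, c'; split=> //.
  exact: comparable_precedes (f_chain eq_f) Fcx Fc'y sep lt_xy.
have [c sep_c] : exists c, F c x != F c y.
  apply/existsP; apply: contraNT neq_xy => /existsPn eq_xy.
  by apply/eqP/setP=> c; rewrite !inE; apply/eqP/negPn/eq_xy.
case Fcx: (F c x) sep_c; case Fcy: (F c y) => // _.
  have: f c \in support y by rewrite -eq_supp; apply/supportP; exists c.
  by case/supportP=> c' Fc'y eq_f; exists c, c'; rewrite Fcy andbF.
have: f c \in support x by rewrite eq_supp; apply/supportP; exists c.
by case/supportP=> c' Fc'x eq_f; exists c', c; rewrite Fcx.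
Qed.

Lemma same_support_fiber_lt x y x' y' :
  support x = support y -> containing x != containing y ->
  (x < y)%O -> containing x' = containing x -> containing y' = containing y ->
  (x' < y')%O.
Proof.
move=> eq_supp neq_xy lt_xy /setP eq_x /setP eq_y.
have eqFx c : F c x' = F c x by have := eq_x c; rewrite !inE.
have eqFy c : F c y' = F c y by have := eq_y c; rewrite !inE.
have [c [c' [Fcx Fc'y sep /asboolP lt_cc']]] :=
  same_support_witness eq_supp neq_xy lt_xy.
by apply: lt_cc'; rewrite ?eqFx ?eqFy.
Qed.

Lemma fiber_chain_colouring :
  chain_colouring (fun Y Z => precedes (fiber Y) (fiber Z)) (fun Y => f @: Y).
Proof.
move=> Y Z eq_supp.
have [->|neqYZ] := eqVneq Y Z; first by rewrite precedes_refl.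
apply/orP; have [[x [y [/eqP xY /eqP yZ lt_xy]]]|no_lt] :=
  pselect (exists x y, [/\ fiber Y x, fiber Z y & (x < y)%O]).
  left; apply/asboolP=> x' y' /eqP x'Y /eqP y'Z _.
  by apply: (@same_support_fiber_lt x y); rewrite /support ?xY ?yZ.
right; apply/asboolP=> y x yZ xY _; rewrite lt_neqAle; apply/andP; split.
  by apply: contraNneq neqYZ => eq_yx; rewrite -(eqP xY) -(eqP yZ) eq_yx.
by rewrite leNgt; apply/negP=> lt_xy; apply: no_lt; exists x, y.
Qed.

Definition potential (K : {set I}) x : nat :=
  \sum_(c in f @^-1: K) progress x c.

Lemma potential_lt K x y :
  support x = K -> support y = K ->
  containing x != containing y -> (x < y)%O -> potential K x < potential K y.
Proof.
move=> suppx suppy neq_xy lt_xy.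
have le_progress c : progress x c <= progress y c by apply/leq_progress/ltW.
suff [c cK lt_c] : exists2 c, f c \in K & progress x c < progress y c.
  rewrite /potential (bigD1 c) ?inE // [ltnRHS](bigD1 c) ?inE //=.
  by rewrite -addSn leq_add // leq_sum.
have eq_supp : support x = support y by rewrite suppx.
have [c [c' [Fcx Fc'y + /asboolP lt_cc']]] :=
  same_support_witness eq_supp neq_xy lt_xy.
rewrite negb_and; case/orP=> [nFc'x|nFcy].
  exists c'; first by rewrite -suppy; apply/supportP; exists c'.
  rewrite (progress_inside Fc'y) progress_before // => [|z Fc'z].
    by exists y.
  by apply: lt_cc'; rewrite // (negPf nFc'x).
exists c; first by rewrite -suppx; apply/supportP; exists c.
rewrite (progress_inside Fcx) progress_after // => [|z Fcz].
  by exists x => //; apply: ltW.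
by apply: lt_cc'; rewrite // (negPf nFcy) andbF.
Qed.

Lemma potential_inj K x y :
  support x = K -> support y = K -> potential K x = potential K y ->
  containing x = containing y.
Proof.
move=> suppx suppy; apply: contra_eq => neq_xy; rewrite neq_ltn.
have /lt_total/orP[lt_xy|lt_yx] : x != y by apply: contraNneq neq_xy => ->.
  by rewrite (potential_lt suppx suppy).
by rewrite (potential_lt suppy suppx) ?orbT // eq_sym.
Qed.

Lemma potential_bounds K x :
  support x = K ->
  #|K| <= potential K x /\ potential K x + #|K| <= 2 * #|f @^-1: K|.
Proof.
move=> suppx; set D := f @^-1: K.
have sub_x : containing x \subset D.
  apply/subsetP=> c; rewrite !inE -suppx => Fcx.
  by apply/supportP; exists c.
have leK : #|K| <= #|containing x| by rewrite -suppx leq_imset_card.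
have inside : \sum_(c in containing x) progress x c = #|containing x|.
  rewrite -sum1_card; apply: eq_bigr => c; rewrite inE; exact: progress_inside.
have outside : \sum_(c in D :\: containing x) progress x c <=
    2 * #|D :\: containing x|.
  by rewrite mulnC -sum_nat_const leq_sum // => c _; apply: progress_leq2.
have := cardsID (containing x) D.
rewrite /potential -/D (big_setID (containing x)) /= (setIidPr sub_x) inside.
lia.
Qed.

Hypothesis f_surj : f @: [set: C] = setT.

Lemma card_traces_support (K : {set I}) :
  #|[set Y in traces | f @: Y == K]| + 2 * #|K| <= (2 * #|f @^-1: K|).+1.
Proof.
set supported := [set Y in traces | f @: Y == K].
pose S : finType := {Y | Y \in supported}.
have cardS : #|S| = #|supported| by apply: card_sig.
have /choice[point pointP] (Y : S) : exists x, containing x = val Y.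
  by have := valP Y; rewrite !inE -andbA => /and3P[_ /asboolP].
have supp (Y : S) : support (point Y) = K.
  by rewrite /support pointP; have := valP Y; rewrite inE => /andP[_ /eqP].
have leK := leq_card_preimset K f_surj.
suff: #|S| + #|K| <= (2 * #|f @^-1: K|).+1 - #|K| by rewrite -cardS; lia.
apply: (@card_leq_interval _ (potential K \o point)); last by lia.
  move=> Y Z /(potential_inj (supp Y) (supp Z)) eqYZ.
  by apply: val_inj; rewrite -!pointP.
by move=> Y /=; have := potential_bounds (supp Y); lia.
Qed.

Lemma card_traces_colouring :
  #|traces| + 2 ^ #|I| * #|I| < 2 ^ #|I| * #|C|.+1.
Proof.
pose N K := #|[set Y in traces | f @: Y == K]|.
have card_traces : #|traces| = \sum_(K : {set I}) N K.
  rewrite -sum1_card (partition_big (fun Y : {set C} => f @: Y) predT) //=.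
  by apply: eq_bigr => K _; rewrite /N -sum1dep_card.
have N0 : N set0 = 0.
  apply/eqP; rewrite cards_eq0; apply/eqP/setP=> Y; rewrite !inE imset_eq0.
  by case: eqP; rewrite ?andbF.
have sum_card : 2 * \sum_(K : {set I}) #|K| = 2 ^ #|I| * #|I|.
  rewrite -(sum_card_preimset id); congr (2 * _).
  by apply: eq_bigr => K _; apply: eq_card => i; rewrite !inE.
rewrite mulnSr -sum_card -(sum_card_preimset f) card_traces -card_set_type.
rewrite -[#|{set I}|]sum1_card !big_distrr -!big_split /=.
rewrite (bigD1 (set0 : {set I})) // [ltnRHS](bigD1 (set0 : {set I})) //=.
rewrite N0 -addSn leq_add ?cards0 ?addn1 //.
by apply: leq_sum => K _; rewrite addn1 card_traces_support.
Qed.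

End Family.

Section FamilyWidth.

Variables (disp : Order.disp_t) (T : orderType disp).
Variables (C : finType) (F : C -> pred T).

Lemma width_fiber (S : finType) (g : S -> {set C}) :
  (forall s, g s != set0) ->
  width (family_le (fiber F \o g)) < 2 ^ width (family_le F).
Proof.
move=> g_neq0; have [f [f_chain _]] := width_colouring (family_le_refl F).
pose h s := f @: g s.
have h_chain : chain_colouring (family_le (fiber F \o g)) h.
  by move=> s t; apply: fiber_chain_colouring.
have h_neq0 s : h s != set0 by rewrite imset_eq0.
apply: leq_ltn_trans (width_leq_imset h_chain) _.
by have := card_imset_nonempty_sets h_neq0; rewrite card_ord.
Qed.

Lemma card_traces_width (r := width (family_le F)) :
  #|traces F| + 2 ^ r * r < 2 ^ r * #|C|.+1.
Proof.
have [f [f_chain f_surj]] := width_colouring (family_le_refl F).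
by have := card_traces_colouring f_chain f_surj; rewrite card_ord.
Qed.

End FamilyWidth.

Section Representatives.

Variables (disp : Order.disp_t) (T : orderType disp).
Variables (C D : finType) (F : C -> pred T) (repr : D -> C) (class : C -> D).
Hypothesis F_repr : forall c, F (repr (class c)) = F c.

Lemma width_family_repr : width (family_le (F \o repr)) = width (family_le F).
Proof.
apply/eqP; rewrite eqn_leq; apply/andP; split.
  by apply: (leq_width_reflect (g := repr)) => //; apply: family_le_refl.
apply: (leq_width_reflect (g := class)) => [|c c']; first exact: family_le_refl.
by rewrite /family_le /= !F_repr.
Qed.

Lemma card_traces_repr : #|traces F| <= #|traces (F \o repr)|.
Proof.
pose restrict (Y : {set C}) := repr @^-1: Y.
have restrict_inj : {in traces F &, injective restrict}.
  move=> Y Z; rewrite !inE => /andP[_ /asboolP[x <-]] /andP[_ /asboolP[y <-]].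
  move=> /setP eq_xy; apply/setP=> c; have := eq_xy (class c).
  by rewrite !inE !F_repr.
rewrite -(card_in_imset restrict_inj); apply/subset_leq_card/subsetP.
move=> _ /imsetP[Y + ->]; rewrite !inE => /andP[/set0Pn[c cY] /asboolP[x eqY]].
move: cY; rewrite -eqY inE => Fcx; apply/andP; split.
  by apply/set0Pn; exists (class c); rewrite !inE F_repr.
by apply/asboolP; exists x; apply/setP=> c'; rewrite !inE.
Qed.

End Representatives.

Lemma card_traces_quotient (disp : Order.disp_t) (T : orderType disp)
    (C : finType) (F : C -> pred T) (r := width (family_le F)) :
  (forall c, exists x, F c x) ->
  #|traces F| + 2 ^ r * r < 2 ^ r * #|preorder_quotient (family_le F)|.+1.
Proof.
move=> F_neq0.
have [D [repr [class [<- classP]]]] :=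
  preorder_quotient_section (family_le_refl F).
have F_repr c : F (repr (class c)) = F c.
  by have /andP[le_c ge_c] := classP c; apply: precedes_anti.
have := card_traces_width (F \o repr); rewrite (width_family_repr F_repr).
by apply: leq_ltn_trans; rewrite leq_add2r (card_traces_repr F_repr).
Qed.

Section Reading.

Variables (Sigma : finType) (A : nfa Sigma).
Implicit Types (alpha beta w : seq Sigma).

Lemma reads_cat (Q : finType) (E : {set Q * Q * Sigma}) (u v : Q) w1 w2 :
  reads E u (w1 ++ w2) v = [exists x, reads E u w1 x && reads E x w2 v].
Proof.
elim: w1 u => [|a w1 IH] u /=.
  apply/idP/existsP => [r2|[x /andP[/eqP-> //]]].
  by exists u; rewrite eqxx.
apply/existsP/existsP => [[y /andP[uy]]|[x /andP[/existsP[y /andP[uy yx]] xv]]].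
  rewrite IH => /existsP[x /andP[yx xv]]; exists x; rewrite xv andbT.
  by apply/existsP; exists y; rewrite uy.
by exists y; rewrite uy IH; apply/existsP; exists x; rewrite yx.
Qed.

Lemma pref_IstringP alpha : pref (language A) alpha <-> Istring A alpha != set0.
Proof.
split=> [[beta /exists_inP[v _]]|/set0Pn[u]].
  rewrite reads_cat => /existsP[u /andP[ru _]].
  by apply/set0Pn; exists u; rewrite inE.
rewrite inE => ru; have [w [v [vF rw]]] := nfa_coreachable u.
exists w; apply/exists_inP; exists v => //.
by rewrite reads_cat; apply/existsP; exists u; rewrite [X in X && _]ru.
Qed.

Lemma eq_Istring_cat alpha beta w :
  Istring A alpha = Istring A beta ->
  Istring A (alpha ++ w) = Istring A (beta ++ w).
Proof.
move=> /setP eqI; apply/setP => v; rewrite !inE /Istate !reads_cat.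
by apply: eq_existsb => x; have := eqI x; rewrite !inE /Istate => ->.
Qed.

Lemma pedges_reads_Istring alpha w (X Y : pstate A) :
  val X = Istring A alpha -> reads (pedges A) X w Y ->
  val Y = Istring A (alpha ++ w).
Proof.
elim: w X alpha => [|a w IH] X alpha eqX /=; first by move/eqP<-; rewrite cats0.
case/existsP=> Z /andP[]; rewrite inE => /asboolP[beta /= [_ eqXb eqZ]].
rewrite -cat_rcons; apply: IH; rewrite [LHS]eqZ -!cats1; apply: eq_Istring_cat.
by rewrite -eqXb.
Qed.

Lemma pstate_neq0 (X : pstate A) : val X != set0.
Proof.
by have := valP X; rewrite inE => /asboolP[alpha [/pref_IstringP + ->]].
Qed.

Lemma Istate_powerset (X : pstate A) w :
  @Istate Sigma (powerset_nfa A) X w = (Istring A w == val X).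
Proof.
apply/idP/eqP=> [|eqX].
  by rewrite /Istate => /(@pedges_reads_Istring [::]) ->.
apply: (@preads _ _ [::]) => //=.
by apply/pref_IstringP; rewrite eqX pstate_neq0.
Qed.

End Reading.

Section CoLexicographic.

Variables (d : Order.disp_t) (Sigma : finOrderType d).

Lemma lang_preceqE (X Y : pred (seq Sigma)) :
  `[< lang_preceq X Y >] =
  precedes (fun w : seqlexi Sigma => X (rev w)) (fun w => Y (rev w)).
Proof.
apply/asboolP/asboolP=> [leXY x y Xx Yy sep|ltXY].
  case: leXY => [eqXY|[_ ltXY]]; first by rewrite -eqXY Xx eqXY Yy in sep.
  rewrite -(revK x) -(revK y); apply: ltXY => // -[[_ Yx] [Xy _]].
  by rewrite Yx Xy in sep.
have [|neqXY] := pselect (X =1 Y); [by left|right; split=> // x y Xx Yy sep].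
apply: ltXY; rewrite !revK //; apply/negP=> /andP[Yx Xy]; exact: sep.
Qed.

Definition reversed_Istate (A : nfa Sigma) (u : state A) :
    pred (seqlexi Sigma) :=
  fun w => Istate u (rev w).

Lemma preceq_family_le (A : nfa Sigma) :
  @preceq d Sigma A = family_le (@reversed_Istate A).
Proof. by do 2!apply/funext=> ?; apply: lang_preceqE. Qed.

Variable A : nfa Sigma.

Lemma Qstar_traces : Qstar A = traces (@reversed_Istate A).
Proof.
have containingE w : containing (@reversed_Istate A) w = Istring A (rev w).
  by apply/setP=> u; rewrite !inE.
apply/setP=> X; rewrite !inE; apply/asboolP/andP.
  move=> [alpha [/pref_IstringP X_neq0 ->]]; split=> //.
  by apply/asboolP; exists (rev alpha); rewrite containingE revK.
case=> X_neq0 /asboolP[w eqX]; exists (rev w).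
by split; [apply/pref_IstringP|]; rewrite -containingE eqX.
Qed.

Lemma reversed_Istate_powerset :
  @reversed_Istate (powerset_nfa A) = fiber (@reversed_Istate A) \o val.
Proof.
apply/funext=> X; apply/funext=> w; rewrite /reversed_Istate Istate_powerset.
by congr (_ == _); apply/setP=> u; rewrite !inE.
Qed.

Lemma width_powerset :
  width (@preceq d Sigma (powerset_nfa A)) < 2 ^ width (@preceq d Sigma A).
Proof.
rewrite !preceq_family_le reversed_Istate_powerset.
exact/width_fiber/pstate_neq0.
Qed.

Lemma card_Qstar (r := width (@preceq d Sigma A)) :
  #|Qstar A| + 2 ^ r * r < 2 ^ r * #|preorder_quotient (@preceq d Sigma A)|.+1.
Proof.
rewrite /r preceq_family_le Qstar_traces; apply: card_traces_quotient => u.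
have [w rw] := nfa_reachable u.
by exists (rev w); rewrite /reversed_Istate revK.
Qed.

End CoLexicographic.

Unset Implicit Arguments.

Theorem theorem9 (d : Order.disp_t) (Sigma : finOrderType d) (A : nfa Sigma)
    (n nstar r rstar : nat) :
  n = #|preorder_quotient (@preceq d Sigma A)| ->
  nstar = #|Qstar A| ->
  r = width (@preceq d Sigma A) ->
  rstar = width (@preceq d Sigma (powerset_nfa A)) ->
  (rstar%:Z <= 2%:Z ^+ r - 1)%R /\
  (nstar%:Z <= 2%:Z ^+ r * (n%:Z - r%:Z + 1) - 1)%R.
Proof.
move=> -> -> -> ->.
have card_bound := card_Qstar A; have width_bound := width_powerset A.
by split; nia.
Qed.
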